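(* Let $G$ be an $n$-vertex graph of maximum degree $\Delta$. For every positive integer $x$, there is a deterministic distributed algorithm in the LOCAL model, operating directly on $G$ (without simulating the line graph of $G$), that computes a proper edge coloring of $G$ with $2^{x+1}\Delta$ colors within $\tilde O\big(x\cdot\Delta^{1/(2x+2)}\big)+O(\log^* n)$ rounds.
   Context: LOCAL model: the input graph is the communication network; each vertex is a processor with a unique ID of $O(\log n)$ bits and unbounded local computation; computation proceeds in synchronous rounds, in each of which every vertex may send a message of arbitrary size to each neighbor; running time is the number of rounds until all vertices terminate. Global parameters ($n$, $\Delta$, $x$) are assumed known to all vertices. In an edge coloring, edges sharing an endpoint receive distinct colors, and both endpoints of an edge must learn its color. $\tilde O(f)$ hides factors polylogarithmic in $\Delta$. *)

(* Defs.v *)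
From mathcomp Require Import all_boot.
Set Implicit Arguments. Unset Strict Implicit. Unset Printing Implicit Defensive.

Definition simple_graph (n : nat) (e : rel 'I_n) : Prop :=
  (forall u v, e u v = e v u) /\ (forall v, e v v = false).

Definition deg (n : nat) (e : rel 'I_n) (v : 'I_n) : nat := #|[pred u | e v u]|.

Definition max_deg (n : nat) (e : rel 'I_n) : nat := \max_(v : 'I_n) deg e v.

(* A deterministic LOCAL algorithm (full-information message passing).
   Each vertex holds a state of an arbitrary type [S].  Initially a vertex
   knows its own ID and its degree.  In every synchronous round each vertex
   sends its entire state to all neighbours (messages of arbitrary size) and
   updates its state by an arbitrary (unbounded) local computation from its
   own state and the received states, indexed by the sender's ID.
   After [rounds] rounds every vertex terminates; [out s j] is the colour
   that a vertex with final state [s] assigns to its incident edge towards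
   the neighbour with ID [j]. *)
Record LocalAlg := {
  la_state : Type;
  la_init : nat -> nat -> la_state;                         (* ID, degree *)
  la_step : la_state -> (nat -> option la_state) -> la_state;
  la_out : la_state -> nat -> nat;
  la_rounds : nat
}.

Fixpoint run_state (A : LocalAlg) (n : nat) (e : rel 'I_n) (id : 'I_n -> nat)
    (t : nat) (v : 'I_n) : la_state A :=
  match t with
  | 0 => la_init A (id v) (deg e v)
  | t'.+1 =>
      la_step (run_state A e id t' v)
        (fun j => match [pick u | e v u && (id u == j)] with
                  | Some u => Some (run_state A e id t' u)
                  | None => None
                  end)
  end.

Definition edge_color (A : LocalAlg) (n : nat) (e : rel 'I_n) (id : 'I_n -> nat)
    (v u : 'I_n) : nat :=
  la_out (run_state A e id (la_rounds A) v) (id u).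

Definition computes_edge_coloring (A : LocalAlg) (n : nat) (e : rel 'I_n)
    (id : 'I_n -> nat) (k : nat) : Prop :=
  (forall u v, e u v -> edge_color A e id u v = edge_color A e id v u) /\
  (forall u v, e u v -> edge_color A e id u v < k) /\
  (forall u v w, e u v -> e u w -> v != w ->
      edge_color A e id u v != edge_color A e id u w).

(* Smallest r with d <= r ^ k, i.e. ceil(d^(1/k)) (for k >= 1). *)
Definition root_up (d k : nat) : nat := find (fun r => d <= r ^ k) (iota 0 d.+1).

Fixpoint logstar_aux (fuel m : nat) : nat :=
  match fuel with
  | 0 => 0
  | f.+1 => if m <= 1 then 0 else (logstar_aux f (trunc_log 2 m)).+1
  end.
Definition logstar (m : nat) : nat := logstar_aux m m.

(* Main.v *)
Require Import Defs.
From Stdlib Require Import FunctionalExtensionality.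
From mathcomp Require Import all_boot all_algebra all_field zify.
Set Implicit Arguments. Unset Strict Implicit. Unset Printing Implicit Defensive.
Import GRing.Theory.

(* Each vertex splits its m edges into groups of size s, and the edges of a
   common group are coloured with 2s - 1 colours; at every vertex a colour then
   occurs at most ceil(m / s) times.  After x + 1 such levels with s close to
   Delta^(1/(x+1)), i.e. to R^2 with R = root_up Delta (2x + 2), the colouring
   is proper.  Since (2s - 1) ceil(m / s) <= 2m when 2s^2 <= m, no colour is lost
   to rounding.

   One level is a list colouring of conflict degree < C = 2s - 1 in sqrt C rounds
   up to logarithms, from an initial colouring with poly(Delta) colours (Linial).
   Initial colours become polynomials of logarithmic degree without constant
   term, over a field of characteristic 2.  While the uncoloured degree is < E:
   - over a field F' with #|F'| about sqrt C, an item tries the values of its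
     polynomial one after the other and keeps the first one with few clashes; by
     counting roots every item keeps a value, and the items with the same value
     have few rivals among those that decided no later;
   - for each value in turn, the items that still have >= E/2 uncoloured
     neighbours translate their polynomial over F vertically so that its graph in
     F x F, which contains the palette, meets many free colours, and pick a free
     colour on it that lies on no rival's graph.
   Afterwards the uncoloured degree is < E/2.  The density of the free colours
   makes the second step work with #|F| about sqrt C at every scale E. *)

(** * The LOCAL model on pairs of adjacent vertices *)

(** The full-information state. Gathering views is all the communication there is; every decision is
    a function of the final view. *)
Inductive view : Type :=
  | View0 of nat
  | ViewS of view & (nat -> option view).

Definition view_alg (T : nat) (out : view -> nat -> nat) : LocalAlg :=
  {| la_state := view; la_init := fun i _ => View0 i; la_step := ViewS;
     la_out := out; la_rounds := T |}.

Fixpoint view_id (w : view) : nat :=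
  match w with View0 i => i | ViewS w' _ => view_id w' end.

Definition view_nbr (w : view) (i : nat) : bool :=
  match w with View0 _ => false | ViewS _ f => isSome (f i) end.

(** The neighbourhood is visible only through counts of neighbours. Hence steps on the conflict
    graph respect [flip], and the two endpoints of an edge can simply add their counts. *)
Definition local_step (X : finType) (S : Type) (adj : rel X)
    (F : S -> (pred S -> nat) -> S) (s : X -> S) (x : X) : S :=
  F (s x) (fun P => #|[pred y | adj x y && P (s y)]|).

Definition local_run (X : finType) (S : Type) (adj : rel X)
    (Fs : seq (S -> (pred S -> nat) -> S)) (s : X -> S) : X -> S :=
  foldl (fun s F => local_step adj F s) s Fs.

Definition flip (T : Type) (x : T * T) : T * T := (x.2, x.1).

(* The vertices of this graph are the ordered pairs (u, v), so that it is the
   line graph of the bipartite double cover; symmetric labellings of it are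
   labellings of the edges.  [g (u, v)] is the group into which [u] puts its
   edge towards [v], and only edges in the same group conflict. *)
Definition conflict (n : nat) (e : rel 'I_n) (Q : eqType)
    (g : 'I_n * 'I_n -> Q) : rel ('I_n * 'I_n) :=
  fun x y => [&& e x.1 x.2, e y.1 y.2 &
    [&& x.1 == y.1, x.2 != y.2 & g x == g y]
    || [&& x.2 == y.2, x.1 != y.1 & g (flip x) == g (flip y)]].

(** * Edge labellings computable in a given number of rounds *)

Section Locality.
Variables (n Delta N : nat).

Definition viewat (e : rel 'I_n) (id : 'I_n -> nat) (t : nat) (v : 'I_n) : view :=
  run_state (view_alg 0 (fun _ _ => 0)) e id t v.

Lemma viewatE T out e id t v : run_state (view_alg T out) e id t v = viewat e id t v.
Proof.
elim: t v => [|t IH] v //=; rewrite /viewat /= IH; congr ViewS.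
by apply: functional_extensionality => j; case: pickP => [w _|//]; rewrite IH.
Qed.

Lemma view_id_viewat e id t v : view_id (viewat e id t v) = id v.
Proof. by elim: t => [|t IH] //=. Qed.

Lemma view_nbr_viewat e id t v i :
  view_nbr (viewat e id t.+1 v) i = [exists w, e v w && (id w == i)].
Proof.
rewrite /=; case: pickP => [w Hw|H] /=; first by symmetry; apply/existsP; exists w.
by symmetry; apply/existsP => -[w]; rewrite H.
Qed.

Lemma pick_nbr (e : rel 'I_n) (id : 'I_n -> nat) u v : injective id -> e u v ->
  [pick w | e u w && (id w == id v)] = Some v.
Proof.
move=> inj euv; case: pickP => [w /andP[_ /eqP/inj ->] //|/(_ v)].
by rewrite euv eqxx.
Qed.

Definition good (e : rel 'I_n) (id : 'I_n -> nat) : Prop :=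
  [/\ simple_graph e, max_deg e = Delta, injective id & forall v, id v < N].

Lemma sum_view_nbr e id t u (h : nat -> nat) : good e id ->
  \sum_(i < N | view_nbr (viewat e id t.+1 u) i) h i = \sum_(w | e u w) h (id w).
Proof.
case=> _ _ inj lt.
pose f w := Ordinal (lt w).
have injf : injective f by move=> a b /(congr1 val) /= /inj.
have -> : \sum_(w | e u w) h (id w) = \sum_(i in f @: [set w | e u w]) h i.
  rewrite big_imset /=; last by move=> a b _ _ /injf.
  by apply: eq_bigl => w; rewrite inE.
apply: eq_bigl => i; rewrite view_nbr_viewat; apply/existsP/imsetP.
  by case=> w /andP[ew /eqP wi]; exists w; rewrite ?inE //; apply/val_inj.
by case=> w; rewrite inE => ew ->; exists w; rewrite ew /=.
Qed.

Definition labelling (S : Type) : Type :=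
  rel 'I_n -> ('I_n -> nat) -> 'I_n * 'I_n -> S.

(** A single [G] must serve every graph and every ID assignment, which is what makes it an
    algorithm. *)
Definition computable (S : Type) (T : nat) (L : labelling S) : Prop :=
  exists G : view -> nat -> S, forall e id u v,
    good e id -> e u v -> G (viewat e id T u) (id v) = L e id (u, v).

Definition symlab (S : Type) (L : labelling S) : Prop :=
  forall e id, good e id -> forall x, L e id (flip x) = L e id x.

Lemma computable_map S S' T (L : labelling S) (h : S -> S') :
  computable T L -> computable T (fun e id x => h (L e id x)).
Proof. by case=> G HG; exists (fun w j => h (G w j)) => e id u v He euv; rewrite HG. Qed.

Lemma computable_pair S S' T (L : labelling S) (L' : labelling S') :
  computable T L -> computable T L' ->
  computable T (fun e id x => (L e id x, L' e id x)).
Proof.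
move=> [G HG] [G' HG']; exists (fun w j => (G w j, G' w j)) => e id u v He euv.
by rewrite HG // HG'.
Qed.

Lemma computableS S T (L : labelling S) : computable T L -> computable T.+1 L.
Proof.
case=> G HG.
exists (fun w j => G (if w is ViewS w' _ then w' else w) j) => e id u v He euv.
exact: HG.
Qed.

Lemma computableD S T k (L : labelling S) : computable T L -> computable (T + k) L.
Proof. by move=> H; elim: k => [|k IH]; rewrite ?addn0 // addnS; apply: computableS. Qed.

Lemma computable_id : computable 0 (fun e id x => (id x.1, id x.2)).
Proof. by exists (fun w j => (view_id w, j)) => e id u v. Qed.

Lemma computable_const S (c : S) T : computable T (fun e id x => c).
Proof. by exists (fun w j => c). Qed.

Lemma computable_count (S : Type) T (L : labelling S) (R : nat -> S -> nat -> S -> bool) :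
  computable T.+1 L ->
  computable T.+1 (fun e id x =>
    \sum_(w | e x.1 w) R (id w) (L e id (x.1, w)) (id x.2) (L e id x)).
Proof.
case=> G HG.
exists (fun w j => \sum_(i < N | view_nbr w i) R i (G w i) j (G w j)) => e id u v He euv.
pose w := viewat e id T.+1 u.
have /= -> := sum_view_nbr T u (fun i => R i (G w i) (id v) (G w (id v))) He.
by apply: eq_bigr => z ez; rewrite /w !(HG e id).
Qed.

(** A pair in conflict with [(u, v)] shares exactly one coordinate with it, so the count splits into
    a part seen by [u] and a part seen by [v]. *)
Lemma card_conflict (e : rel 'I_n) (Q : eqType) (g : 'I_n * 'I_n -> Q)
    (P : pred ('I_n * 'I_n)) u v : symmetric e -> e u v ->
  #|[pred y | conflict e g (u, v) y && P y]|
  = \sum_(w | e u w) [&& w != v, g (u, w) == g (u, v) & P (u, w)]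
  + \sum_(w | e v w) [&& w != u, g (v, w) == g (v, u) & P (w, v)].
Proof.
move=> es euv; rewrite -sum1_card big_mkcond /=.
transitivity (\sum_(y : 'I_n * 'I_n)
   ((if y.1 == u then
      (if e u y.2 then [&& y.2 != v, g (u, y.2) == g (u, v) & P (u, y.2)] : nat else 0)
    else 0)
  + (if y.2 == v then
      (if e v y.1 then [&& y.1 != u, g (v, y.1) == g (v, u) & P (y.1, v)] : nat else 0)
    else 0))).
  apply: eq_bigr => -[a b] _ /=; rewrite inE /conflict /flip /= euv /=.
  rewrite (eq_sym u a) (eq_sym v b).
  case: (eqVneq a u) => [->|nau]; case: (eqVneq b v) => [->|nbv] /=;
    rewrite ?eqxx ?andbF ?andbT ?orbF ?(es v a) ?addn0 //=.
  - by case: (e u v) (e v u) => [] [].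
  - by case: (e u b) => //=; rewrite (eq_sym (g (u, v))); case: (g _ == _) => //=; case: (P _).
  - by case: (e a v) => //=; rewrite (eq_sym (g (v, u))); case: (g _ == _) => //=; case: (P _).
rewrite big_split /=; congr addn.
  rewrite -(pair_bigA _ (fun a b => if a == u then
     (if e u b then [&& b != v, g (u, b) == g (u, v) & P (u, b)] : nat else 0) else 0)) /=.
  rewrite (bigD1 u) //= [X in _ + X]big1 ?addn0; last by move=> a /negPf ->; rewrite big1.
  by rewrite [RHS]big_mkcond; apply: eq_bigr => b _; rewrite eqxx.
rewrite -(pair_bigA _ (fun a b => if b == v then
   (if e v a then [&& a != u, g (v, a) == g (v, u) & P (a, v)] : nat else 0) else 0)) /=.
rewrite [RHS]big_mkcond; apply: eq_bigr => a _.
by rewrite (bigD1 v) //= eqxx big1 ?addn0 // => b /negPf ->.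
Qed.

Lemma conflict_flip (e : rel 'I_n) (Q : eqType) (g : 'I_n * 'I_n -> Q) x y :
  symmetric e -> conflict e g (flip x) (flip y) = conflict e g x y.
Proof.
by case: x y => [a b] [c d] es; rewrite /conflict /flip /= (es b) (es d) orbC.
Qed.

Lemma conflict_sym (e : rel 'I_n) (Q : eqType) (g : 'I_n * 'I_n -> Q) :
  symmetric (conflict e g).
Proof.
move=> x y; rewrite /conflict andbCA !(eq_sym y.1) !(eq_sym y.2).
by rewrite (eq_sym (g y)) (eq_sym (g (flip y))).
Qed.

Lemma symlab_step S (Q : eqType) (L : labelling S) (g : labelling Q) F :
  symlab L -> symlab (fun e id => local_step (conflict e (g e id)) F (L e id)).
Proof.
move=> sL e id He x; have [[es _] _ _ _] := He.
rewrite /local_step sL //; congr F; apply: functional_extensionality => P.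
rewrite -(card_image (f := @flip 'I_n)); last by move=> [a b] [c d] [-> ->].
apply: eq_card => y; apply/imageP/idP => [[z]|].
  rewrite !inE => /andP[cz Pz] ->; rewrite sL // Pz andbT.
  by rewrite -(conflict_flip _ _ _ es); case: (x) (z) cz => a b [c d].
rewrite inE => /andP[cy Py]; exists (flip y); last by case: (y).
by rewrite inE conflict_flip // sL // cy.
Qed.

(** In the extra round [u] receives the view of [v], which determines the labels of the pairs
    [(v, w)]; by symmetry these are the labels of the pairs [(w, v)]. *)
Lemma computable_step S (Q : eqType) T (L : labelling S) (g : labelling Q) F :
  symlab L -> computable T.+1 L -> computable T.+1 g ->
  computable T.+2 (fun e id => local_step (conflict e (g e id)) F (L e id)).
Proof.
move=> sL [G HG] [Gg HGg].
pose cnt w j (P : pred S) := \sum_(i < N | view_nbr w i)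
  [&& i != j :> nat, Gg w i == Gg w j & P (G w i)].
(* The default in [odflt] is never reached, as [j] is the ID of a neighbour. *)
exists (fun w' j => if w' is ViewS w f then
   F (G w j) (fun P => cnt w j P + cnt (odflt w (f j)) (view_id w) P)
   else G w' j) => e id u v He euv.
have [[es _] _ inj lt] := He.
have evu : e v u by rewrite es.
have -> : viewat e id T.+2 u = ViewS (viewat e id T.+1 u)
   (fun j => match [pick w | e u w && (id w == j)] with
             | Some w => Some (viewat e id T.+1 w) | None => None end) by [].
rewrite pick_nbr // HG //= /local_step; congr F; apply: functional_extensionality => P.
rewrite card_conflict // /cnt -/(viewat e id T.+1 u) -/(viewat e id T.+1 v).
have /= -> := sum_view_nbr T u (fun i => [&& i != id v,
  Gg (viewat e id T.+1 u) i == Gg (viewat e id T.+1 u) (id v) &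
  P (G (viewat e id T.+1 u) i)]) He.
change (view_id _) with (view_id (viewat e id T.+1 u)); rewrite view_id_viewat.
have /= -> := sum_view_nbr T v (fun i => [&& i != id u,
  Gg (viewat e id T.+1 v) i == Gg (viewat e id T.+1 v) (id u) &
  P (G (viewat e id T.+1 v) i)]) He.
congr addn; apply: eq_bigr => w ew; rewrite !HG // !HGg // (inj_eq inj) //.
by rewrite -(sL e id He (v, w)).
Qed.

Lemma computable_run S (Q : eqType) T (L : labelling S) (g : labelling Q) Fs :
  symlab L -> computable T.+1 L -> computable T.+1 g ->
  symlab (fun e id => local_run (conflict e (g e id)) Fs (L e id)) /\
  computable (T.+1 + size Fs)
    (fun e id => local_run (conflict e (g e id)) Fs (L e id)).
Proof.
elim: Fs T L => [|F Fs IH] T L sL cL cg; first by rewrite addn0.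
rewrite /= addnS -addSn; apply: IH (computableS cg).
  exact: symlab_step.
exact: computable_step.
Qed.

End Locality.

(** * Trial polynomials and colour reduction *)

Section Trial.
Variables (F : finFieldType) (r : nat).
Local Open Scope ring_scope.

Definition bits (c : nat) : r.-tuple bool :=
  nth [tuple of nseq r false] (enum {: r.-tuple bool}) c.

Lemma bits_inj c c' : (c < 2 ^ r)%N -> (c' < 2 ^ r)%N -> bits c = bits c' -> c = c'.
Proof.
move=> lc lc' /eqP; rewrite nth_uniq ?enum_uniq ?(eqP) //.
- by move/eqP.
- by rewrite -cardE card_tuple card_bool.
- by rewrite -cardE card_tuple card_bool.
Qed.

(** Without constant terms, two distinct trial polynomials never differ by a constant; the common
    leading term makes each of them nonconstant. *)
Definition trial_poly (c : nat) : {poly F} :=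
  'X * ('X^r + \poly_(j < r) (nth false (bits c) j)%:R).

Definition trial (c : nat) (t : F) : F := (trial_poly c).[t].

Lemma card_roots (p : {poly F}) k (A : pred F) : p != 0 -> (size p <= k.+1)%N ->
  (forall t, A t -> root p t) -> (#|A| <= k)%N.
Proof.
move=> p0 sp H; rewrite cardE -ltnS; apply: leq_trans sp.
apply: max_poly_roots => //; last exact: enum_uniq.
by apply/allP => t; rewrite mem_enum => /H.
Qed.

(** Some bit differs and leaves a coefficient [1] or [-1] in positive degree, so the difference is
    nonzero whatever the vertical shift [b], and has few roots. *)
Lemma trial_agree c c' b : (c < 2 ^ r)%N -> (c' < 2 ^ r)%N -> c != c' ->
  (#|[pred t | (trial c t == trial c' t + b)%R]| <= r.+1)%N.
Proof.
move=> lc lc' ncc'.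
pose D := \poly_(j < r) ((nth false (bits c) j)%:R : F)
          - \poly_(j < r) (nth false (bits c') j)%:R.
have E : trial_poly c - trial_poly c' - b%:P = 'X * D - b%:P.
  by rewrite /trial_poly -mulrBr opprD addrACA subrr add0r.
apply: (@card_roots ('X * D - b%:P)).
- apply/eqP => /polyP Z; move/eqP: ncc'; apply; apply: bits_inj => //.
  apply: val_inj; apply: (@eq_from_nth _ false); rewrite !size_tuple // => j jr.
  have := Z j.+1; rewrite coefB coefXM coefC subr0 coef0 /= coefB !coef_poly jr.
  case: (nth _ _ _); case: (nth _ _ _) => //= /eqP;
    rewrite ?subr0 ?sub0r ?oppr_eq0 ?oner_eq0 //.
- apply: leq_trans (size_polyD _ _) _; rewrite size_polyN geq_max.
  rewrite (leq_trans (size_polyC_leq1 _)) // andbT.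
  apply: leq_trans (size_polyMleq _ _) _; rewrite size_polyX /= ltnS (leqW) //.
  apply: leq_trans (size_polyD _ _) _; rewrite size_polyN geq_max.
  by rewrite !size_poly.
- move=> t /= /eqP H; rewrite -E /root !hornerD !hornerN hornerC.
  by rewrite -/(trial c t) -/(trial c' t) H addrAC addrK subrr.
Qed.

Lemma trial_value c f : (#|[pred t | trial c t == f]| <= r.+1)%N.
Proof.
have sP : size ('X^r + \poly_(j < r) ((nth false (bits c) j)%:R : F)) = r.+1.
  by rewrite size_polyDl size_polyXn // ltnS size_poly.
have sT : size (trial_poly c) = r.+2.
  by rewrite /trial_poly mulrC size_mulX ?sP // -size_poly_eq0 sP.
have sF : size (trial_poly c - f%:P) = r.+2.
  by rewrite size_polyDl sT // size_polyN (leq_ltn_trans (size_polyC_leq1 _)).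
apply: (@card_roots (trial_poly c - f%:P)).
- by rewrite -size_poly_eq0 sF.
- by rewrite sF.
- by move=> t /= /eqP H; rewrite /root hornerD hornerN hornerC -/(trial c t) H subrr.
Qed.

End Trial.

Lemma sum_nat_pred (X : finType) (P Q : pred X) :
  \sum_(y | P y) (Q y : nat) = #|[pred y | P y && Q y]|.
Proof. by rewrite -sum1_card big_mkcondr; apply: eq_bigr => y _; case: (Q y). Qed.

(** * Linial's colour reduction *)

Section Reduction.
Variables (F : finFieldType) (r : nat).

Definition reduce (c : nat) (N : pred nat -> nat) : nat :=
  if [pick t : F | N (fun c' => trial r c' t == trial r c t) == 0] is Some t
  then index (t, trial r c t) (enum {: F * F}) else 0.

Variables (X : finType) (adj : rel X) (c : X -> nat) (D : nat).

(** Each of the at most [D] neighbours spoils at most [r.+1] points, so an unspoiled point exists.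
    Equal new colours would mean the same point and the same value there. *)
Lemma reduceP :
  (forall x y, adj x y -> c x != c y) -> (forall x, c x < 2 ^ r) ->
  (forall x, #|[pred y | adj x y]| <= D) -> D * r.+1 < #|F| ->
  (forall x y, adj x y -> local_step adj reduce c x != local_step adj reduce c y) /\
  (forall x, local_step adj reduce c x < #|F| ^ 2).
Proof.
move=> pr lt dg q.
have ex x : {t : F | [forall y, adj x y ==> (trial r (c y) t != trial r (c x) t)] &
   local_step adj reduce c x = index (t, trial r (c x) t) (enum {: F * F})}.
  rewrite /local_step /reduce; case: pickP => [t|N].
    move=> /eqP/card0_eq H; exists t => //; apply/forallP => y; apply/implyP => axy.
    by have := H y; rewrite inE axy /= => ->.
  exfalso; move: q; rewrite ltnNge => /negP; apply.
  apply: (@leq_trans (\sum_(y | adj x y) \sum_(t : F) (trial r (c y) t == trial r (c x) t))).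
    rewrite exchange_big -sum1_card; apply: leq_sum => t _.
    by rewrite sum_nat_pred lt0n; apply: negbT; apply: N.
  apply: (@leq_trans (\sum_(y | adj x y) r.+1)).
    apply: leq_sum => y axy; rewrite sum_nat_pred /=.
    have ne : c y != c x by rewrite eq_sym pr.
    apply: leq_trans (trial_agree 0%R (lt y) (lt x) ne).
    by apply/eq_leq/eq_card => t; rewrite !inE GRing.addr0.
  by rewrite sum_nat_const leq_mul2r dg orbT.
split=> [x y axy|x]; last first.
  have [t _ ->] := ex x.
  by rewrite -mulnn -card_prod cardE index_mem mem_enum.
have [t Ht ->] := ex x; have [t' _ ->] := ex y.
have In p : p \in enum {: F * F} by rewrite mem_enum.
apply/eqP => /index_inj -/(_ (0, 0)%R (In _) (In _)) [] E.
by rewrite -E => /eqP; apply/negP; rewrite eq_sym; move/forallP/(_ y)/implyP: Ht; apply.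
Qed.

End Reduction.

(** * List colouring in O~(sqrt C) rounds *)

Section ListColoring.
Variables (F F' : finFieldType) (r : nat) (Pal : {set F * F}).

(* [hue] is an initial proper colour, [col] the final colour, [cls] the class
   together with the time at which it was chosen, and [shf] the vertical shift
   of the graph of the trial polynomial from which [col] will be chosen. *)
Record item := Item {
  hue : nat;
  col : option (F * F);
  cls : option (F' * nat);
  shf : option F }.

Definition blank (a : item) : bool := ~~ isSome (col a).

Definition in_class (f : F') (a : item) : bool :=
  if cls a is Some (f', _) then f' == f else false.

Definition clear (a : item) (_ : pred item -> nat) : item :=
  Item (hue a) (col a) None None.

(** These are the neighbours that may be in the tried class after this step: those already in it and
    those trying the same value now. *)
Definition clash (t : F') (a y : item) : bool :=
  blank y && (if cls y is Some (f, _) then trial r (hue a) t == f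
              else trial r (hue y) t == trial r (hue a) t).

Definition try_class (b : nat) (tk : F' * nat) (a : item) (N : pred item -> nat) : item :=
  if [&& blank a, ~~ isSome (cls a) & N (clash tk.1 a) <= b]
  then Item (hue a) (col a) (Some (trial r (hue a) tk.1, tk.2)) (shf a) else a.

Definition free (N : pred item -> nat) : {set F * F} :=
  [set p in Pal | N (fun y => col y == Some p) == 0].

Definition best_shift (A : {set F * F}) (c : nat) : F :=
  [arg max_(b > 0%R) #|[set t : F | (t, trial r c t + b)%R \in A]|].

Definition pick_shift (f : F') (E : nat) (a : item) (N : pred item -> nat) : item :=
  if [&& blank a, in_class f a & E <= N blank]
  then Item (hue a) (col a) (cls a) (Some (best_shift (free N) (hue a))) else a.

(** Ignoring rivals that joined the class later keeps the blockers few, and it is safe: of two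
    rivals at least one takes the other into account. *)
Definition blocks (k : nat) (p : F * F) (y : item) : bool :=
  if shf y is Some b then
    (if cls y is Some (_, k') then k' <= k else false)
    && (p.2 == trial r (hue y) p.1 + b)%R
  else false.

Definition pick_color (a : item) (N : pred item -> nat) : item :=
  if shf a is Some b then
    let k := if cls a is Some (_, k) then k else 0 in
    Item (hue a)
      [pick p in free N | (p.2 == trial r (hue a) p.1 + b)%R && (N (blocks k p) == 0)]
      (cls a) None
  else a.

Definition phase (b E : nat) : seq (item -> (pred item -> nat) -> item) :=
  clear :: [seq try_class b tk | tk <- zip (enum F') (iota 0 #|F'|)]
  ++ flatten [seq [:: pick_shift f E; pick_color] | f <- enum F'].

(** An average over the trials: each of fewer than [E] uncoloured neighbours causes at most [r.+1]
    clashes while undecided and [r.+1] through its class. *)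
Definition defect (E : nat) : nat := (2 * r.+1 * E) %/ #|F'|.

Fixpoint phases (p E : nat) : seq (item -> (pred item -> nat) -> item) :=
  if p is p'.+1 then phase (defect E) E./2 ++ phases p' E./2 else [::].

Lemma size_phases p E : size (phases p E) = p * (3 * #|F'|).+1.
Proof.
elim: p E => //= p IH E; rewrite size_cat IH mulSn; congr (_.+1 + _).
rewrite size_cat size_map size_zip size_iota -cardE minnn size_flatten /shape -map_comp.
rewrite (eq_map (_ : _ =1 fun _ => 2)) // sumnE big_map big_const_seq count_predT.
by rewrite -cardE iter_addn_0 mulSn.
Qed.

(** * Correctness of the list colouring *)

Variables (X : finType) (adj : rel X) (h : X -> nat) (C : nat).
Hypothesis adj_sym : symmetric adj.
Hypothesis h_proper : forall x y, adj x y -> h x != h y.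
Hypothesis h_lt : forall x, h x < 2 ^ r.
Hypothesis deg_lt : forall x, #|[pred y | adj x y]| < C.
Hypothesis card_Pal : #|Pal| = C.
Hypothesis card_F' : 4 * r.+1 ^ 2 * #|F| <= #|F'|.

Implicit Types (s : X -> item) (x y : X).

Definition blanks s x : nat := #|[pred y | adj x y && blank (s y)]|.

Definition rivals s x (f : F') (k : nat) : {set X} :=
  [set y | [&& adj x y, blank (s y) &
    (if cls (s y) is Some (f', k') then (f' == f) && (k' <= k) else false)]].

Definition sound s : Prop :=
  [/\ forall x, hue (s x) = h x, forall x, shf (s x) = None &
      forall x p, col (s x) = Some p -> p \in Pal /\ forall y, adj x y -> col (s y) != Some p].

Definition classified (b : nat) s : Prop := forall x, blank (s x) ->
  exists f k, cls (s x) = Some (f, k) /\ #|rivals s x f k| <= b.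

Lemma run_cat (S : Type) (Fs Gs : seq (S -> (pred S -> nat) -> S)) (s : X -> S) :
  local_run adj (Fs ++ Gs) s = local_run adj Gs (local_run adj Fs s).
Proof. by rewrite /local_run foldl_cat. Qed.

Lemma step_try b t k s x : local_step adj (try_class b (t, k)) s x =
  if [&& blank (s x), ~~ isSome (cls (s x)) & #|[pred y | adj x y && clash t (s x) (s y)]| <= b]
  then Item (hue (s x)) (col (s x)) (Some (trial r (hue (s x)) t, k)) (shf (s x)) else s x.
Proof. by []. Qed.

(** Invariant of the trials. Each failed trial of [x] saw at least [b.+1] clashes, charged to
    neighbours [y]: the two polynomials agree there, or the value of [x] is the class of [y]. *)
Definition tried b s0 (ts : seq F') s : Prop :=
  [/\ forall x, hue (s x) = hue (s0 x), forall x, col (s x) = col (s0 x),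
      forall x, shf (s x) = shf (s0 x) &
  forall x, blank (s x) ->
    match cls (s x) with
    | Some (f, k) => k < size ts /\ #|rivals s x f k| <= b
    | None => b.+1 * size ts <=
       \sum_(y | adj x y && blank (s y)) \sum_(t <- ts)
          ((trial r (hue (s y)) t == trial r (hue (s x)) t)
           + (if cls (s y) is Some (f, _) then trial r (hue (s x)) t == f else false))
    end].

Lemma tried_step b s0 ts t s : tried b s0 ts s ->
  tried b s0 (rcons ts t) (local_step adj (try_class b (t, size ts)) s).
Proof.
case=> eh ec es ek; set s' := local_step _ _ _.
have hE x : hue (s' x) = hue (s x) by rewrite /s' step_try; case: ifP.
have cE x : col (s' x) = col (s x) by rewrite /s' step_try; case: ifP.
have bE x : blank (s' x) = blank (s x) by rewrite /blank cE.
have kE x fk : cls (s x) = Some fk -> cls (s' x) = Some fk.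
  by move=> E; rewrite /s' step_try E /= andbF.
have kN x : cls (s x) = None -> forall f k, cls (s' x) = Some (f, k) ->
  [/\ f = trial r (hue (s x)) t, k = size ts &
      #|[pred y | adj x y && clash t (s x) (s y)]| <= b].
  move=> E f k; rewrite /s' step_try E /=; case: ifP => [/andP[_ H]|_] /=.
    by case=> <- <-.
  by rewrite E.
split.
- by move=> x; rewrite hE.
- by move=> x; rewrite cE.
- by move=> x; rewrite -es /s' step_try; case: ifP.
move=> x; rewrite bE => bx; have := ek x bx.
case E: (cls (s x)) => [[f k]|].
  rewrite (kE _ _ E) size_rcons => -[lk Hr]; split; first exact: ltnW.
  (* A class chosen now carries the time [size ts], which exceeds [k], so no rival is added. *)
  apply: leq_trans Hr; apply: subset_leq_card; apply/subsetP => y.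
  rewrite !inE bE => /and3P[-> ->] /=.
  case Ey: (cls (s y)) => [fk|]; first by rewrite (kE _ _ Ey).
  case Ey': (cls (s' y)) => [[f' k']|] //; have [_ -> _] := kN _ Ey _ _ Ey'.
  by rewrite leqNgt lk andbF.
move=> Hs; case E': (cls (s' x)) => [[f k]|].
  have [-> -> Hc] := kN _ E _ _ E'; rewrite size_rcons; split=> //.
  apply: leq_trans Hc; apply: subset_leq_card; apply/subsetP => y.
  rewrite !inE bE /clash => /and3P[-> ->] /=.
  case Ey: (cls (s y)) => [[f' k']|].
    by rewrite (kE _ _ Ey) => /andP[/eqP-> _].
  by case Ey': (cls (s' y)) => [[f' k']|] //; have [-> _ _] := kN _ Ey _ _ Ey' => /andP[].
rewrite size_rcons mulnS addnC.
have Hb : b < #|[pred y | adj x y && clash t (s x) (s y)]|.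
  move: E'; rewrite /s' step_try E bx /=; case: ifP => //=.
  by rewrite ltnNge => ->.
rewrite (eq_bigl (fun y => adj x y && blank (s y))); last by move=> y; rewrite bE.
apply: leq_trans (leq_add Hs Hb) _.
have -> : #|[pred y | adj x y && clash t (s x) (s y)]| =
   \sum_(y | adj x y && blank (s y)) (clash t (s x) (s y)).
  rewrite sum_nat_pred; apply: eq_card => y; rewrite !inE /clash.
  by case: (adj x y); case: (blank (s y)).
rewrite -big_split; apply: leq_sum => y /andP[_ by_].
rewrite -cats1 big_cat big_seq1 /=; apply: leq_add.
  apply: leq_sum => t' _; rewrite !hE leq_add2l.
  by case Ey: (cls (s y)) => [[f k]|] //; rewrite (kE _ _ Ey).
rewrite !hE /clash by_ /=; case Ey: (cls (s y)) => [[f k]|]; last by rewrite leq_addr.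
by rewrite (kE _ _ Ey) leq_addl.
Qed.

Lemma tried_run b s0 us ts s : tried b s0 ts s ->
  tried b s0 (ts ++ us)
    (local_run adj [seq try_class b tk | tk <- zip us (iota (size ts) (size us))] s).
Proof.
elim: us ts s => [|t us IH] ts s H; first by rewrite cats0.
have := IH _ _ (tried_step t H).
by rewrite size_rcons cat_rcons.
Qed.

(** Failing every trial takes [(defect E).+1 * #|F'|] clashes, more than fewer than [E] uncoloured
    neighbours can cause. *)
Lemma classify E s : sound s -> (forall x, blank (s x) -> blanks s x < E) ->
  let s' := local_run adj
    (clear :: [seq try_class (defect E) tk | tk <- zip (enum F') (iota 0 #|F'|)]) s in
  [/\ sound s', forall x, col (s' x) = col (s x) & classified (defect E) s'].
Proof.
move=> [sh ss sc] sb s'.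
pose s0 := local_step adj clear s.
have T0 : tried (defect E) s0 [::] s0 by split=> // x _ /=; rewrite muln0.
have := tried_run (enum F') T0; rewrite /= -cardE.
have <- : s' = local_run adj
  [seq try_class (defect E) tk | tk <- zip (enum F') (iota 0 #|F'|)] s0 by [].
case=> eh ec es ek.
have cE x : col (s' x) = col (s x) by rewrite ec.
have hE x : hue (s' x) = h x by rewrite eh /= sh.
split=> //; first split=> //.
  by move=> x p; rewrite cE => /sc [? H]; split=> // y; rewrite cE; apply: H.
move=> x bx; have := ek x bx.
case: (cls _) => [[f k] [_ H]|]; first by exists f, k.
rewrite -cardE => H; exfalso; move: H; apply/negP; rewrite -ltnNge.
apply: (@leq_ltn_trans (\sum_(y | adj x y && blank (s' y)) (2 * r.+1))).
  apply: leq_sum => y /andP[axy _]; rewrite big_split mul2n -addnn; apply: leq_add.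
    rewrite big_enum sum_nat_pred /= !hE.
    have ne : h y != h x by rewrite eq_sym h_proper.
    apply: leq_trans (trial_agree 0%R (h_lt y) (h_lt x) ne).
    by apply/eq_leq/eq_card => t; rewrite !inE addr0.
  case: (cls (s' y)) => [[f k]|]; last by rewrite big1.
  rewrite big_enum sum_nat_pred /=; apply: leq_trans (trial_value _ (hue (s' x)) f).
  by apply/eq_leq/eq_card.
rewrite sum_nat_const mulnC.
apply: (@leq_ltn_trans (2 * r.+1 * E)); last by apply: ltn_ceil; apply/card_gt0P; exists 0%R.
rewrite leq_mul2l orbC ltnW //.
have bx' : blank (s x) by rewrite /blank -cE.
apply: leq_ltn_trans (sb x bx'); apply: eq_leq.
by apply: eq_card => y; rewrite !inE unfold_in /blank cE.
Qed.

Definition remaining s x : {set F * F} :=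
  [set p in Pal | #|[pred y | adj x y && (col (s y) == Some p)]| == 0].

(** There are more colours than neighbours, and a coloured neighbour removes at most one colour. *)
Lemma card_remaining s x : blanks s x < #|remaining s x|.
Proof.
have H : Pal \subset remaining s x :|:
    [set odflt (0, 0)%R (col (s y)) | y in [set y | adj x y && ~~ blank (s y)]].
  apply/subsetP => p pP; rewrite !inE pP /=; case: eqP => //= /eqP.
  rewrite -lt0n => /card_gt0P [y].
  rewrite inE => /andP[axy /eqP Ey]; apply/imsetP; exists y; last by rewrite Ey.
  by rewrite inE axy /blank Ey.
have := subset_leq_card H; rewrite card_Pal => /leq_trans /(_ (leq_card_setU _ _).1) H1.
have := leq_trans H1 (leq_add (leqnn _) (leq_imset_card _ _)).
have D0 : #|[pred y | adj x y]| = blanks s x + #|[set y | adj x y & ~~ blank (s y)]|.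
  rewrite -[LHS](cardID [pred y | blank (s y)]); congr addn.
  by apply: eq_card => y; rewrite !inE andbC.
by have := deg_lt x; rewrite D0 => D1 D2; have := leq_trans D1 D2; rewrite ltn_add2r.
Qed.

(** The [#|F|] vertical translates of a graph partition the plane, so the best one holds at least
    the average share of [A]. *)
Lemma best_shiftP (A : {set F * F}) c :
  #|A| <= #|F| * #|[set t : F | (t, trial r c t + best_shift A c)%R \in A]|.
Proof.
rewrite /best_shift; case: arg_maxnP => // b _ Hb.
have -> : #|A| = \sum_(b : F) #|[set t : F | (t, trial r c t + b)%R \in A]|.
  rewrite -sum1_card (eq_bigl (fun p => (p \in A))) // big_mkcond /=.
  transitivity (\sum_(p : F * F) if (p.1, p.2) \in A then 1 else 0); first by apply: eq_bigr => -[].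
  rewrite -(pair_bigA _ (fun t z => if (t, z) \in A then 1 else 0)) /=.
  under [RHS]eq_bigr => b' _ do rewrite cardsE -sum1_card big_mkcond /=.
  rewrite [RHS]exchange_big; apply: eq_bigr => t _.
  by rewrite (reindex_inj (addrI (trial r c t))).
rewrite -sum_nat_const; apply: leq_sum => b' _; exact: Hb.
Qed.

Definition shift_of s x : F := best_shift (remaining s x) (h x).

(** More than [E./2] colours remain, so the translated graph meets more than [E./2 / #|F|] of them.
    Each item of [O] blocks at most [r.+1] of these, and by [card_F'] this is too little to block
    all. *)
Lemma unblocked_color E s x k (O : {set X}) (g : X -> F) :
  blanks s x < E -> E./2 <= blanks s x -> #|O| <= defect E ->
  {in O, forall y, adj x y} -> k = shift_of s x ->
  exists p, [/\ p \in remaining s x, p.2 = (trial r (h x) p.1 + k)%R &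
    forall y, y \in O -> p.2 != (trial r (h y) p.1 + g y)%R].
Proof.
move=> lE gE cO aO ->; set b := shift_of s x.
pose T := [set t : F | (t, trial r (h x) t + b)%R \in remaining s x].
pose Bad y := [set t : F | (trial r (h x) t == trial r (h y) t + (g y - b))%R].
have [t tT tB] : exists2 t, t \in T & t \notin \bigcup_(y in O) Bad y.
  apply/exists_inP; apply: contraT; rewrite negb_exists_in => /forall_inP H.
  have sub : T \subset \bigcup_(y in O) Bad y.
    by apply/subsetP => t /H; rewrite negbK.
  have c1 : #|T| <= defect E * r.+1.
    apply: leq_trans (subset_leq_card sub) _.
    have cU : #|\bigcup_(y in O) Bad y| <= \sum_(y in O) #|Bad y|.
      elim/big_rec2: _ => [|y m A _ IH]; first by rewrite cards0.
      by apply: leq_trans (leq_card_setU _ _).1 _; rewrite leq_add2l.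
    apply: leq_trans cU _; apply: (@leq_trans (\sum_(y in O) r.+1)); last first.
      by rewrite sum_nat_const leq_mul2r cO orbT.
    apply: leq_sum => y yO; rewrite cardsE; apply: trial_agree => //.
    exact/h_proper/aO.
  have := best_shiftP (remaining s x) (h x); rewrite -/(shift_of s x) -/b -/T.
  move=> c2; have c3 := card_remaining s x.
  have c4 : defect E * #|F'| <= 2 * r.+1 * E by apply: leq_divM.
  (* The unit lost in halving is harmless: it is compared with an even number, and [card_remaining]
     is strict. *)
  have c5 : E <= 2 * E./2 + 1.
    by rewrite -[X in X <= _]odd_double_half mul2n addnC leq_add2l leq_b1.
  move: lE gE c1 c2 c3 c4 c5 card_F'.
  move: (blanks s x) #|remaining s x| #|T| (defect E) #|F| #|F'| (E./2) => B R t d q q' E2.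
  set a := r.+1; have a0 : 0 < a by [].
  move: a a0 => a a0 lE gE c1 c2 c3 c4 c5 c6.
  have : d * (4 * a ^ 2 * q) <= 2 * a * E by apply: leq_trans c4; rewrite leq_mul2l c6 orbT.
  have -> : d * (4 * a ^ 2 * q) = 2 * a * (2 * (q * (d * a))) by rewrite -mulnn; lia.
  rewrite leq_pmul2l ?muln_gt0 // => c7.
  have c8 : q * t <= q * (d * a) by rewrite leq_mul2l c1 orbT.
  lia.
exists (t, trial r (h x) t + b)%R; split=> //=; first by rewrite inE in tT.
move=> y yO; apply: contra tB => /eqP E1; apply/bigcupP; exists y => //.
by rewrite inE addrA -E1 addrK.
Qed.

(** Of two adjacent items that act at once, one that chose its class no earlier avoids the graph of
    the other. An item of class [f] that stays blank did not act, hence has fewer than [E./2] blank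
    neighbours. *)
Lemma pick_class E f s :
  sound s -> classified (defect E) s -> (forall x, blank (s x) -> blanks s x < E) ->
  let s' := local_run adj [:: pick_shift f E./2; pick_color] s in
  [/\ sound s', forall x, blank (s' x) -> blank (s x),
      forall x, cls (s' x) = cls (s x) &
      forall x, blank (s' x) -> in_class f (s' x) -> blanks s' x < E./2].
Proof.
move=> [sh ss sc] sk sb.
pose s1 := local_step adj (pick_shift f E./2) s.
pose s2 := local_step adj pick_color s1.
rewrite -[local_run _ _ _]/s2.
pose act x := [&& blank (s x), in_class f (s x) & E./2 <= blanks s x].
have s1E x : s1 x = if act x then Item (hue (s x)) (col (s x)) (cls (s x))
    (Some (best_shift (remaining s x) (hue (s x)))) else s x by [].
have col1 x : col (s1 x) = col (s x) by rewrite s1E; case: ifP.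
have hue1 x : hue (s1 x) = h x by rewrite s1E -sh; case: ifP.
have cls1 x : cls (s1 x) = cls (s x) by rewrite s1E; case: ifP.
have shf1 x : shf (s1 x) = if act x then Some (shift_of s x) else None.
  by rewrite s1E sh /shift_of; case: ifP.
have rem1 x : remaining s1 x = remaining s x.
  apply/setP => p; rewrite !inE; congr (_ && (_ == _)); apply: eq_card => y.
  by rewrite !inE col1.
have s2N x : ~~ act x -> s2 x = s x.
  by move=> /negPf N; rewrite /s2 /local_step /pick_color shf1 N s1E N.
have cls2 x : cls (s2 x) = cls (s x).
  by rewrite /s2 /local_step /pick_color; case: (shf _) => [b|] //=; rewrite cls1.
have s2A x : act x -> exists p, [/\ col (s2 x) = Some p, p \in remaining s x,
    p.2 = (trial r (h x) p.1 + shift_of s x)%R &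
    forall y, adj x y -> act y ->
      (if cls (s y) is Some (_, k) then k else 0)
        <= (if cls (s x) is Some (_, k) then k else 0) ->
      p.2 <> (trial r (h y) p.1 + shift_of s y)%R].
  move=> ax; have [bx fx ex] := and3P ax.
  have [f0 [k [Ek rk]]] := sk x bx.
  have f0E : f0 = f by move: fx; rewrite /in_class Ek => /eqP.
  move: Ek rk; rewrite {}f0E => Ek rk.
  (* Every neighbour that can block [x] acts in class [f] with a time at most [k], so it is one of
     these few rivals. *)
  have [//|p [p1 p2 p3]] := @unblocked_color E s x _ (rivals s x f k) (shift_of s)
     (sb x bx) ex rk _ erefl; first by move=> y; rewrite inE => /and3P[].
  rewrite /s2 /local_step /pick_color shf1 ax /= cls1 Ek hue1.
  have -> : free (fun P => #|[pred y | adj x y && P (s1 y)]|) = remaining s x by rewrite -rem1.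
  case: pickP => [p' /and3P[]|].
    move=> pr /eqP pe /eqP/card0_eq pb; exists p'; split=> //.
    move=> y axy ay; have := pb y; rewrite inE axy /blocks shf1 ay cls1 hue1 /=.
    have [by_ fy ey] := and3P ay; have [f1 [k1 [Ek1 _]]] := sk y by_.
    by rewrite Ek1 inE => + lk; rewrite lk => /negbT/eqP.
  move=> /(_ p); rewrite p1 p2 eqxx /= => /eqP; case.
  apply/eqP; rewrite -leqn0 leqNgt; apply/negP => /card_gt0P [y].
  rewrite inE /blocks shf1 cls1 hue1 => /andP[axy]; case: ifP => // ay.
  have [by_ fy ey] := and3P ay; move: fy; rewrite /in_class.
  case Ey: (cls (s y)) => [[f1 k1]|] // /eqP f1E /andP[lk /eqP pe].
  have /p3 : y \in rivals s x f k by rewrite inE axy by_ Ey f1E eqxx.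
  by rewrite p2 in pe *; rewrite pe eqxx.
have blank2 x : blank (s2 x) -> ~~ act x.
  by apply: contraL => /s2A [p [E1 _ _ _]]; rewrite /blank E1.
split.
- split.
  + move=> x; rewrite /s2 /local_step /pick_color; case: (shf _) => [b|] /=; exact: hue1.
  + move=> x; rewrite /s2 /local_step /pick_color; case Eb: (shf (s1 x)) => [b|] //=.
  + move=> x p Ep; have [ax|nax] := boolP (act x).
      have [p' [Ep' pr pe pb]] := s2A x ax; move: Ep; rewrite Ep' => -[Epp]; subst p'.
      move: (pr); rewrite inE => /andP[pP /eqP/card0_eq pc]; split=> // y axy.
      have [ay|nay] := boolP (act y); last first.
        by rewrite (s2N y nay); have := pc y; rewrite inE axy /= => ->.
      have [p' [Ey _ ye yb]] := s2A y ay; rewrite Ey; apply/eqP => -[Epp]; subst p'.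
      have [l|l] := leqP (if cls (s y) is Some (_, k) then k else 0)
                        (if cls (s x) is Some (_, k) then k else 0).
        exact: (pb y axy ay l).
      by apply: (yb x _ ax (ltnW l)) => //; rewrite adj_sym.
    move: Ep; rewrite s2N // => Ep; have [pP pc] := sc x p Ep; split=> // y axy.
    have [ay|nay] := boolP (act y); last by rewrite s2N //; apply: pc.
    have [p' [-> pr _ _]] := s2A y ay; apply/eqP => -[Epp]; subst p'.
    move: pr; rewrite inE => /andP[_ /eqP/card0_eq/(_ x)].
    by rewrite inE adj_sym axy Ep eqxx.
- by move=> x bx; rewrite -(s2N x (blank2 x bx)).
- exact: cls2.
- move=> x bx fx; have nax := blank2 x bx; have nax0 := nax.
  have sub : blanks s2 x <= blanks s x.
    apply: subset_leq_card; apply/subsetP => y; rewrite !inE => /andP[-> by_] /=.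
    by have := blank2 y by_ => nay; rewrite -(s2N _ nay).
  apply: leq_ltn_trans sub _; move: nax; rewrite /act.
  move: fx; rewrite /in_class cls2 => ->.
  have -> : blank (s x) by rewrite -(s2N x nax0).
  by rewrite /= -ltnNge.
Qed.

Lemma blanks_mono s s' x : (forall y, blank (s' y) -> blank (s y)) -> blanks s' x <= blanks s x.
Proof.
move=> H; apply: subset_leq_card; apply/subsetP => y.
by rewrite !inE => /andP[-> /H].
Qed.

Lemma classified_mono b s s' : (forall x, blank (s' x) -> blank (s x)) ->
  (forall x, cls (s' x) = cls (s x)) -> classified b s -> classified b s'.
Proof.
move=> H K cl x /H /cl [f [k [E1 E2]]]; exists f, k; split; first by rewrite K.
apply: leq_trans E2; apply: subset_leq_card; apply/subsetP => y.
by rewrite !inE K => /and3P[-> /H -> ->].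
Qed.

(** Blank items only become fewer and classes stay fixed, so the hypotheses survive from one class
    to the next. *)
Lemma pick_classes E fs s :
  sound s -> classified (defect E) s -> (forall x, blank (s x) -> blanks s x < E) ->
  let s' := local_run adj (flatten [seq [:: pick_shift f E./2; pick_color] | f <- fs]) s in
  [/\ sound s', forall x, blank (s' x) -> blank (s x),
      forall x, cls (s' x) = cls (s x) &
      forall x f, f \in fs -> blank (s' x) -> in_class f (s' x) -> blanks s' x < E./2].
Proof.
elim: fs s => [|f fs IH] s sd cl sb; first by split.
have [sd1 bl1 cls1 done1] := pick_class f sd cl sb.
set s1 := local_run _ _ s in sd1 bl1 cls1 done1.
have cl1 := classified_mono bl1 cls1 cl.
have sb1 x : blank (s1 x) -> blanks s1 x < E.
  by move=> /bl1 /sb; apply: leq_ltn_trans; apply: blanks_mono.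
have [sd2 bl2 cls2 done2] := IH s1 sd1 cl1 sb1.
have -> : local_run adj (flatten [seq [:: pick_shift f E./2; pick_color] | f <- f :: fs]) s
  = local_run adj (flatten [seq [:: pick_shift f E./2; pick_color] | f <- fs]) s1 by [].
move: sd2 bl2 cls2 done2; set s2 := local_run _ _ s1 => sd2 bl2 cls2 done2.
split=> // [x /bl2 /bl1 //|x|x f'].
  by rewrite cls2.
rewrite inE => /predU1P[-> bx fx|]; last exact: done2.
apply: leq_ltn_trans (blanks_mono _ bl2) _; apply: done1; first exact: bl2.
by move: fx; rewrite /in_class cls2.
Qed.

Lemma phaseP E s : sound s -> (forall x, blank (s x) -> blanks s x < E) ->
  let s' := local_run adj (phase (defect E) E./2) s in
  sound s' /\ (forall x, blank (s' x) -> blanks s' x < E./2).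
Proof.
move=> sd sb.
have [sd1 col1 cl1] := classify sd sb.
set s1 := local_run _ _ s in sd1 col1 cl1.
have bl1 x : blank (s1 x) -> blank (s x) by rewrite /blank col1.
have sb1 x : blank (s1 x) -> blanks s1 x < E.
  by move=> /bl1 /sb; apply: leq_ltn_trans; apply: blanks_mono.
have [sd2 bl2 cls2 done2] := pick_classes (enum F') sd1 cl1 sb1.
rewrite /phase -cat_cons run_cat -/s1.
move: sd2 bl2 cls2 done2; set s2 := local_run _ _ s1 => sd2 bl2 cls2 done2.
split=> // x bx; have [f [k [Ek _]]] := cl1 x (bl2 x bx).
by apply: (done2 x f); rewrite ?mem_enum // /in_class cls2 Ek.
Qed.

(** The bound halves in each phase; once it is [0], no item can be blank. *)
Lemma phasesP p E s : sound s -> (forall x, blank (s x) -> blanks s x < E) -> E < 2 ^ p ->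
  let s' := local_run adj (phases p E) s in sound s' /\ forall x, ~~ blank (s' x).
Proof.
elim: p E s => [|p IH] E s sd sb lE.
  split=> // x; apply/negP => /sb.
  by case: E lE {sb} => [|E].
have -> : local_run adj (phases p.+1 E) s = local_run adj (phases p E./2)
  (local_run adj (phase (defect E) E./2) s) by exact: run_cat.
have [sd1 sb1] := phaseP sd sb; apply: IH => //.
by rewrite ltn_half_double -mul2n -expnS.
Qed.

Definition palette_index (a : item) : nat :=
  if col a is Some p then index p (enum Pal) else 0.

Lemma list_coloring p : C < 2 ^ p ->
  let s := local_run adj (phases p C) (fun x => Item (h x) None None None) in
  (forall x, palette_index (s x) < C) /\
  (forall x y, adj x y -> palette_index (s x) != palette_index (s y)).
Proof.
move=> lC s.
have sd0 : sound (fun x => Item (h x) None None None) by [].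
have sb0 x : blank (Item (h x) None None None) ->
    blanks (fun x => Item (h x) None None None) x < C.
  move=> _; apply: leq_ltn_trans (deg_lt x); apply: subset_leq_card.
  by apply/subsetP => y; rewrite !inE andbT.
have [[_ _ sc] bl] := phasesP sd0 sb0 lC; rewrite -/s in sc bl.
have cS x : exists2 q, col (s x) = Some q & q \in enum Pal.
  have := bl x; rewrite /blank negbK; case E: (col (s x)) => [q|] // _.
  by exists q; rewrite // mem_enum; case: (sc x q E).
split=> [x|x y axy]; rewrite /palette_index.
  have [q -> qP] := cS x.
  by rewrite -card_Pal cardE index_mem.
have [q Ex qP] := cS x; have [q' Ey qP'] := cS y; rewrite Ex Ey.
apply/eqP =>  /(index_inj (0, 0)%R qP qP') Eq; have [_ /(_ y axy)] := sc x q Ex.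
by rewrite Ey Eq ?eqxx.
Qed.

End ListColoring.

(** * One level of edge grouping *)

Lemma card_le_inj (T : finType) (A : pred T) (f : T -> nat) k :
  {in A &, injective f} -> (forall w, A w -> f w < k) -> #|A| <= k.
Proof.
move=> inj lt; rewrite cardE -(size_map f) -(size_iota 0 k); apply: uniq_leq_size.
  by rewrite map_inj_in_uniq ?enum_uniq // => a b; rewrite !mem_enum; apply: inj.
by move=> i /mapP [w]; rewrite mem_enum mem_iota add0n => /lt ? ->.
Qed.

Section Level.
Variables (n Delta N : nat).
Local Notation good := (@good n Delta N).
Local Notation labelling := (labelling n).
Local Notation computable := (@computable n Delta N _).
Local Notation symlab := (@symlab n Delta N _).

Definition rank (tot : labelling nat) : labelling nat := fun e id x =>
  \sum_(w | e x.1 w) ((tot e id (x.1, w) == tot e id x) && (id w < id x.2)).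

Definition class_le (tot : labelling nat) (B : nat) : Prop :=
  forall e id u v, good e id -> e u v ->
    #|[pred w | e u w && (tot e id (u, w) == tot e id (u, v))]| <= B.

Lemma rank_inj (tot : labelling nat) e id u v w : good e id -> e u v -> e u w ->
  tot e id (u, v) = tot e id (u, w) -> rank tot e id (u, v) = rank tot e id (u, w) -> v = w.
Proof.
case=> _ _ inj _.
suff H v' w' : e u v' -> tot e id (u, v') = tot e id (u, w') -> id v' < id w' ->
    rank tot e id (u, v') < rank tot e id (u, w').
  move=> ev ew Et Er; apply: inj; case: (ltngtP (id v) (id w)) => // lt.
    by have := H _ _ ev Et lt; rewrite Er ltnn.
  by have := H _ _ ew (esym Et) lt; rewrite Er ltnn.
move=> ev Et lt; rewrite /rank !sum_nat_pred /=; apply: proper_card; apply/properP; split.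
  by apply/subsetP => z; rewrite !inE Et => /and3P[-> -> /= /ltn_trans]; apply.
by exists v'; rewrite !inE ev Et eqxx ?ltnn.
Qed.

Lemma rank_lt (tot : labelling nat) B e id u v : good e id -> class_le tot B -> e u v ->
  rank tot e id (u, v) < B.
Proof.
move=> He cl ev; apply: leq_trans (cl e id u v He ev).
rewrite /rank sum_nat_pred /=; apply: proper_card; apply/properP; split.
  by apply/subsetP => z; rewrite !inE => /and3P[-> -> _].
by exists v; rewrite !inE ev eqxx ?ltnn.
Qed.

(** The edges of one label at [x.1] are cut by rank into blocks of [s]; keeping the label limits
    conflicts to edges not yet separated there. *)
Definition group (tot : labelling nat) (s : nat) : labelling (nat * nat) :=
  fun e id x => (tot e id x, rank tot e id x %/ s).

Lemma group_le (tot : labelling nat) s e id u v : good e id -> 0 < s -> e u v ->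
  #|[pred w | e u w && (group tot s e id (u, w) == group tot s e id (u, v))]| <= s.
Proof.
move=> He s0 ev; apply: (card_le_inj (f := fun w => rank tot e id (u, w) %% s)).
  move=> w w'; rewrite !inE => /andP[ew /eqP [Et Ed]] /andP[ew' /eqP [Et' Ed']] Em.
  apply: (rank_inj (tot := tot) He ew ew'); first by rewrite Et.
  by rewrite (divn_eq (rank _ _ _ (u, w)) s) Ed Em -Ed' -divn_eq.
by move=> w _; rewrite ltn_mod.
Qed.

Lemma computable_group (tot : labelling nat) s T :
  computable T.+1 tot -> computable T.+1 (group tot s).
Proof.
move=> c; apply: computable_pair => //.
apply: (computable_map (fun k => k %/ s)).
exact: (computable_count (fun i l j l' => (l == l') && (i < j))).
Qed.

Lemma conflict_deg (tot : labelling nat) s e id x : good e id -> 0 < s ->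
  #|[pred y | conflict e (group tot s e id) x y]| < s.*2.-1.
Proof.
case: x => u v He s0; have [[es _] _ _ _] := He.
case ev: (e u v); last first.
  rewrite eq_card0; first by case: s s0 => // s _; rewrite doubleS.
  by move=> y; rewrite !inE /conflict /= ev.
have -> : #|[pred y | conflict e (group tot s e id) (u, v) y]|
  = #|[pred y | conflict e (group tot s e id) (u, v) y && predT y]|.
  by apply: eq_card => y; rewrite !inE andbT.
rewrite card_conflict //.
have H a b : e a b -> \sum_(w | e a w) [&& w != b,
    group tot s e id (a, w) == group tot s e id (a, b) & true] < s.
  move=> eab; rewrite sum_nat_pred; apply: leq_trans (group_le tot He s0 eab).
  apply: proper_card; apply/properP; split.
    by apply/subsetP => z; rewrite !inE andbT => /and3P[-> _ ->].
  by exists b; rewrite !inE ?eab eqxx.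
have := H _ _ ev; have := H v u; rewrite es ev => /(_ isT).
set a := \sum_(_ | _) _; set b := \sum_(_ | _) _; lia.
Qed.

Definition adjacent (e : rel 'I_n) : rel ('I_n * 'I_n) := conflict e (fun=> tt).

Variables (F F' : finFieldType) (r : nat) (h : labelling nat).
Hypothesis h_sym : symlab h.
Hypothesis h_proper : forall e id, good e id -> forall x y, adjacent e x y -> h e id x != h e id y.
Hypothesis h_lt : forall e id, good e id -> forall x, h e id x < 2 ^ r.
Hypothesis card_F' : 4 * r.+1 ^ 2 * #|F| <= #|F'|.

(** The new colour separates edges of a common group. Edges at [u] with equal refined labels thus
    lie in different groups of one class of at most [B] edges, and there are at most [ceil(B / s)]
    of these groups. *)
Lemma level (tot : labelling nat) T M B s p :
  computable T.+1 h -> computable T.+1 tot -> symlab tot -> class_le tot B ->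
  (forall e id, good e id -> forall x, tot e id x < M) ->
  0 < s -> s.*2 <= #|F| ^ 2 -> s.*2 <= 2 ^ p ->
  exists tot' : labelling nat,
    [/\ computable (T.+1 + p * (3 * #|F'|).+1) tot', symlab tot',
        class_le tot' ((B + s.-1) %/ s) &
        forall e id, good e id -> forall x, tot' e id x < M * s.*2.-1].
Proof.
move=> ch ct st cl lt s0 sF sp; set C := s.*2.-1.
have sC : C < s.*2 by rewrite /C; case: (s) s0 => // s' _; rewrite doubleS.
have C0 : 0 < C by rewrite /C; case: (s) s0 => // s' _; rewrite doubleS.
have [Pal cP] : exists Pal : {set F * F}, #|Pal| = C.
  have : C <= #|[set: F * F]| by rewrite cardsT card_prod mulnn (leq_trans (ltnW sC)).
  by case/card_geqP => l [ul <- _]; exists [set x in l]; rewrite cardsE (card_uniqP ul).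
pose L0 : labelling (item F F') := fun e id x => Item (h e id x) None None None.
pose g := group tot s.
pose Fs := @phases F F' r Pal p C.
pose L : labelling (item F F') := fun e id => local_run (conflict e (g e id)) Fs (L0 e id).
have c0 : computable T.+1 L0 by apply: (computable_map (fun c => Item c None None None)).
have s0' : symlab L0 by move=> e id He x; rewrite /L0 h_sym.
have [sL cL] := computable_run Fs s0' c0 (computable_group s ct).
pose pal e id x := palette_index Pal (L e id x).
have palP e id : good e id -> (forall x, pal e id x < C) /\
    (forall x y, conflict e (g e id) x y -> pal e id x != pal e id y).
  move=> He; apply: list_coloring => //.
  - exact: conflict_sym.
  - move=> x y cxy; apply: (h_proper He).
    case/and3P: cxy => e1 e2; rewrite /adjacent /conflict e1 e2.
    by move=> /orP[] /and3P[-> -> _]; rewrite ?orbT.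
  - exact: h_lt.
  - by move=> x; apply: conflict_deg.
  - exact: leq_trans sC sp.
exists (fun e id x => tot e id x * C + pal e id x); split.
- apply: (computable_map (fun ab => ab.1 * C + ab.2) (L := fun e id x => (tot e id x, pal e id x))).
  apply: computable_pair; first exact: computableD.
  by rewrite -(size_phases F' r Pal p C); apply: (computable_map (palette_index Pal)).
- by move=> e id He x; rewrite st //; congr (_ + palette_index Pal _); exact: sL.
- move=> e id u v He ev; have [pl pp] := palP e id He.
  have dec w w' :
      tot e id (u, w) * C + pal e id (u, w) = tot e id (u, w') * C + pal e id (u, w') ->
      tot e id (u, w) = tot e id (u, w') /\ pal e id (u, w) = pal e id (u, w').
    move=> E; have := congr1 (fun k => k %/ C) E; have := congr1 (fun k => k %% C) E.
    by rewrite !modnMDl !divnMDl // !modn_small // !divn_small // !addn0.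
  apply: (card_le_inj (f := fun w => rank tot e id (u, w) %/ s)).
    move=> w w'; rewrite !inE => /andP[ew /eqP/dec[Et Ep]] /andP[ew' /eqP/dec[Et' Ep']] Er.
    apply/eqP; apply: contraT => ne; have := pp (u, w) (u, w').
    rewrite Ep -Ep' eqxx => H; apply: H; rewrite /conflict /= ew ew' eqxx ne /=.
    by rewrite /g /group Et Et' Er eqxx.
  move=> w /andP[ew _]; have := rank_lt He cl ew.
  case: B {cl} => // B; rewrite ltnS => lB.
  rewrite addSn -addnS prednK // divnDr // divnn s0 addn1 ltnS.
  exact: leq_div2r.
- move=> e id He x; have [pl pp] := palP e id He.
  have l1 := lt e id He x; have l2 := pl x.
  apply: (@leq_trans ((tot e id x).+1 * C)); last by rewrite leq_mul2r l1 orbT.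
  by rewrite mulSn addnC ltn_add2r.
Qed.

End Level.

(** * Iterating the reduction and the levels *)

Lemma finField_pow2 k : 0 < k -> exists F : finFieldType, #|F| = 2 ^ k.
Proof. by move=> k0; have [F _ cF] := pPrimePowerField (isT : prime 2) k0; exists F. Qed.

Lemma trunc_log_lt m y : m < 2 ^ y -> 0 < y -> trunc_log 2 m < y.
Proof.
case: m => [|m] lt y0; first by rewrite trunc_log0.
rewrite ltnNge; apply/negP => le; move: lt; rewrite ltnNge => /negP; apply.
by apply: leq_trans (trunc_logP (isT : 1 < 2) (ltn0Sn m)); rewrite leq_exp2l.
Qed.

(** Bit length after one reduction over a field with [2 ^ k > D * r.+1] elements, which leaves
    [2 ^ (2 * k)] colours. *)
Definition reduced_bits (D r : nat) : nat := 2 * (trunc_log 2 (D * r.+1)).+1.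

(** The bound reproduces its shape: the logarithm of [D * r.+1] stays below [2 * l + k + B + 4], and
    doubling gives the same form with [k] for [m]. *)
Lemma reduced_bits_le D l B m r : D < 2 ^ l -> 1 < B -> 0 < m ->
  r <= 4 * l + B * m + (2 * B + 8) ->
  reduced_bits D r <= 4 * l + B * trunc_log 2 m + (2 * B + 8).
Proof.
move=> lD B1 m0 lr; set k := trunc_log 2 m.
have lm : m < 2 * 2 ^ k by rewrite -expnS; apply: trunc_log_ltn.
have H : r.+1 <= 2 ^ (l + k + (B + 4)).
  have e1 : 0 < 2 ^ l by rewrite expn_gt0.
  have e2 : 0 < 2 ^ k by rewrite expn_gt0.
  have e3 : l < 2 ^ l by apply: ltn_expl.
  have e4 : B < 2 ^ B by apply: ltn_expl.
  rewrite !expnD -[2 ^ 4]/16; move: e1 e2 e3 e4 lm; move: (2 ^ l) (2 ^ k) (2 ^ B) => a b c.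
  move=> e1 e2 e3 e4 lm.
  have h1 : a <= a * b by nia.
  have h2 : b <= a * b by nia.
  have h3 : B * m <= B * (2 * (a * b)) by rewrite leq_mul2l; lia.
  have h4 : a * b * (16 * B.+1) <= a * b * (16 * c) by rewrite leq_mul2l; lia.
  have -> : a * b * (c * 16) = a * b * (16 * c) by lia.
  apply: leq_trans h4; move: lr h1 h2 h3; set ab := a * b => lr h1 h2 h3; nia.
have : trunc_log 2 (D * r.+1) < l + (l + k + (B + 4)).
  apply: trunc_log_lt; last lia.
  by rewrite expnD; apply: leq_ltn_trans (leq_mul (leqnn D) H) _;
     rewrite ltn_pmul2r ?expn_gt0.
have : 2 * k <= B * k by rewrite leq_mul2r B1 orbT.
rewrite /reduced_bits; lia.
Qed.

Lemma iter_reduced_bits D l B f m r : D < 2 ^ l -> 1 < B -> m <= f ->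
  r <= 4 * l + B * trunc_log 2 m + (2 * B + 8) ->
  iter (logstar_aux f m) (reduced_bits D) r <= 4 * l + (2 * B + 8).
Proof.
move=> lD B1; elim: f m r => [|f IH] m r /=.
  by rewrite leqn0 => /eqP ->; rewrite trunc_log0 muln0 addn0.
move=> lm lr; case: (leqP m 1) => [m1|m1].
  by move: lr; case: m m1 {lm} => [|[|]] //=; rewrite ?trunc_log0 ?trunc_log1 muln0 addn0.
have k0 : 0 < trunc_log 2 m by rewrite trunc_log_gt0.
rewrite iterSr; apply: IH; last exact: reduced_bits_le.
have : trunc_log 2 m < m; last lia.
apply: leq_trans (trunc_logP (isT : 1 < 2) (ltnW m1)); exact: ltn_expl.
Qed.

Lemma root_upP d k : 0 < k -> d <= root_up d k ^ k /\ root_up d k <= d.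
Proof.
move=> k0; have hd : has (fun r => d <= r ^ k) (iota 0 d.+1).
  apply/hasP; exists d; first by rewrite mem_iota add0n /=.
  by case: d => // d; rewrite -{1}(expn1 d.+1) leq_pexp2l.
have := hd; rewrite has_find size_iota => lt; split; last by rewrite -ltnS.
by have := nth_find 0 hd; rewrite nth_iota.
Qed.

(** Rounding costs nothing while [2 * s ^ 2 <= m]. Take [s = S] if this holds, else the largest such
    [s]; the factor [8] makes room for [m < 2 * s.+1 ^ 2 <= 8 * s ^ 2]. *)
Lemma group_size m S x : 0 < S -> 0 < m -> m <= 8 * S ^ x.+2 ->
  exists s, [/\ 0 < s, s <= S, s.*2.-1 * ((m + s.-1) %/ s) <= 2 * m &
    0 < (m + s.-1) %/ s <= 8 * S ^ x.+1].
Proof.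
move=> S0 m0 lm.
have e0 : S <= S ^ x.+1 by rewrite -{1}(expn1 S) leq_pexp2l.
have main s : 0 < s -> s <= S -> 2 * s ^ 2 <= m -> m <= s * (8 * S ^ x.+1) ->
  exists s, [/\ 0 < s, s <= S, s.*2.-1 * ((m + s.-1) %/ s) <= 2 * m &
    0 < (m + s.-1) %/ s <= 8 * S ^ x.+1].
  move=> s0 sS sm mS; exists s; split=> //.
    rewrite -(leq_pmul2l s0); have := leq_divM (m + s.-1) s.
    set q := _ %/ s; case: s s0 sS sm mS @q => // s _ sS sm mS q /= h.
    rewrite mulnCA (mulnC _ q) -mulnn in sm *.
    have : s.*2.+1 * (q * s.+1) <= s.*2.+1 * (m + s) by rewrite leq_mul2l h orbT.
    move=> h2; apply: leq_trans h2 _; rewrite -addnn; nia.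
  rewrite divn_gt0 //; apply/andP; split; first lia.
  rewrite -ltnS ltn_divLR // mulSn mulnC; lia.
have [h|h] := leqP (2 * S ^ 2) m.
  by apply: (main S) => //; move: lm; rewrite expnS; lia.
pose P s := 2 * s ^ 2 <= m.
have exP : exists s, P s by exists 0.
have ubP s : P s -> s <= m by rewrite /P -mulnn; nia.
case: (ex_maxnP exP ubP) => s sP smax.
have sS : s < S.
  by rewrite ltnNge; apply/negP => le; move: sP h; rewrite /P -!mulnn; nia.
have ms : m < 2 * s.+1 ^ 2 by rewrite ltnNge; apply/negP => /smax; rewrite ltnn.
case: s sP smax sS ms => [|s] sP smax sS ms.
  (* Only [0] satisfies [P], which forces [m = 1]; groups of size [1] then do. *)
  have -> : m = 1 by move: ms; rewrite exp1n; lia.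
  by exists 1; split=> //; rewrite divn1; lia.
apply: (main s.+1) => //; first exact: ltnW.
by move: ms sS e0; rewrite -!mulnn; nia.
Qed.

(** * Initial colouring and the sequence of levels *)

Section Colouring.
Variables (n Delta N : nat).
Local Notation good := (@good n Delta N).
Local Notation labelling := (labelling n).
Local Notation computable := (@computable n Delta N _).
Local Notation symlab := (@symlab n Delta N _).
Local Notation class_le := (@class_le n Delta N).

Lemma deg_le e id u : good e id -> #|[pred w | e u w]| <= Delta.
Proof. by case=> _ <- _ _; apply: (leq_bigmax u (F := fun v => deg e v)). Qed.

Lemma adjacent_deg e id x : good e id -> #|[pred y | adjacent e x y]| <= 2 * Delta.
Proof.
case: x => u v He; have [[es _] _ _ _] := He.
case ev: (e u v); last first.
  by rewrite eq_card0 // => y; rewrite !inE /adjacent /conflict /= ev.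
have -> : #|[pred y | adjacent e (u, v) y]| = #|[pred y | adjacent e (u, v) y && predT y]|.
  by apply: eq_card => y; rewrite !inE andbT.
rewrite card_conflict // mul2n -addnn; apply: leq_add.
  rewrite sum_nat_pred; apply: leq_trans (deg_le u He); apply: subset_leq_card.
  by apply/subsetP => w; rewrite !inE => /andP[].
rewrite sum_nat_pred; apply: leq_trans (deg_le v He); apply: subset_leq_card.
by apply/subsetP => w; rewrite !inE => /andP[].
Qed.

Definition edge_proper (h : labelling nat) (m : nat) : Prop :=
  forall e id, good e id ->
    (forall x y, adjacent e x y -> h e id x != h e id y) /\
    (forall x, h e id x < m).

(** The unordered pair of end IDs in base [N]; sorting makes it symmetric. *)
Definition id_label : labelling nat := fun e id x =>
  minn (id x.1) (id x.2) * N + maxn (id x.1) (id x.2).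

Lemma id_label_proper : edge_proper id_label (N * N).
Proof.
move=> e id [_ _ inj lt]; split=> [[u v] [u' v']|[u v]]; rewrite /id_label /=; last first.
  have := lt u; have := lt v; set a := id u; set b := id v => la lb.
  apply: (@leq_trans ((minn a b).+1 * N)); last by rewrite leq_mul2r; lia.
  by rewrite mulSn addnC ltn_add2r; lia.
have dec a b a' b' : b < N -> b' < N -> a * N + b = a' * N + b' -> a = a' /\ b = b'.
  move=> lb lb' E; have N0 : 0 < N by lia.
  have := congr1 (fun k => k %/ N) E; have := congr1 (fun k => k %% N) E.
  by rewrite !modnMDl !divnMDl // !modn_small // !divn_small // !addn0.
move=> /and3P[_ _ H]; apply/eqP => /dec.
have := lt u; have := lt v; have := lt u'; have := lt v' => l1 l2 l3 l4.
case; [by lia | by lia | move=> E1 E2].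
case/orP: H => /and3P[/eqP /= e1 /eqP e2 _]; apply: e2; apply: inj;
  by subst; lia.
Qed.

Lemma computable_id_label : computable 1 id_label.
Proof.
apply: computableS; have := computable_id n Delta N.
exact: (computable_map (fun p => minn p.1 p.2 * N + maxn p.1 p.2)).
Qed.

Lemma reduce_step h r T : computable T.+1 h -> symlab h -> edge_proper h (2 ^ r) ->
  exists h', [/\ computable T.+2 h', symlab h' &
    edge_proper h' (2 ^ reduced_bits (2 * Delta) r)].
Proof.
move=> ch sh ph; set k := (trunc_log 2 (2 * Delta * r.+1)).+1.
have [F cF] := finField_pow2 (ltn0Sn _ : 0 < k).
exists (fun e id => local_step (adjacent e) (reduce F r) (h e id)); split.
- by apply: (computable_step (g := fun _ _ _ => tt)) => //; apply: computable_const.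
- exact: (symlab_step (fun _ _ _ => tt) _ sh).
- move=> e id He; have [p1 p2] := ph e id He.
  rewrite /reduced_bits -/k mulnC expnM -cF.
  apply: reduceP p1 p2 (fun x => adjacent_deg x He) _.
  by rewrite cF; apply: trunc_log_ltn.
Qed.

Lemma reduce_iter h r T t : computable T.+1 h -> symlab h -> edge_proper h (2 ^ r) ->
  exists h', [/\ computable (T + t).+1 h', symlab h' &
    edge_proper h' (2 ^ iter t (reduced_bits (2 * Delta)) r)].
Proof.
move=> ch sh ph; elim: t => [|t [h' [c' s' p']]]; first by exists h; rewrite addn0.
by rewrite addnS; exact: (reduce_step c' s' p').
Qed.

(** The ID labels have [O(K log n)] bits. A reduction costs one round and turns the part depending
    on [n] into its logarithm, so [logstar n] reductions remove it. *)
Lemma initial_coloring K l : 0 < K -> N = n ^ K -> 2 * Delta < 2 ^ l ->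
  exists h, [/\ computable (logstar n).+1 h, symlab h &
    edge_proper h (2 ^ (4 * l + (4 * K + 8)))].
Proof.
move=> K0 EN lD; set r0 := 2 * K * (trunc_log 2 n).+1.
have s0 : symlab id_label by move=> e id _ x; rewrite /id_label /= minnC maxnC.
have lN : N * N <= 2 ^ r0.
  have : n <= 2 ^ (trunc_log 2 n).+1 by apply/ltnW/trunc_log_ltn.
  rewrite -(leq_exp2r _ _ K0) -EN -expnM => lN.
  rewrite /r0 -mulnA mul2n -addnn expnD (mulnC K); exact: leq_mul.
have p0 : edge_proper id_label (2 ^ r0).
  move=> e id He; have [h1 h2] := id_label_proper He; split=> // x.
  exact: leq_trans lN.
have [h [ch sh ph]] := reduce_iter (logstar n) computable_id_label s0 p0.
exists h; split=> // e id He; have [h1 h2] := ph e id He; split=> // x.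
apply: leq_trans (h2 x) _; rewrite leq_exp2l //.
have -> : 4 * K = 2 * (2 * K) by lia.
apply: iter_reduced_bits => //; first lia.
rewrite /r0 mulnS; lia.
Qed.

Variables (F F' : finFieldType) (r p S : nat) (h : labelling nat).
Hypothesis h_sym : symlab h.
Hypothesis h_proper : edge_proper h (2 ^ r).
Hypothesis card_F' : 4 * r.+1 ^ 2 * #|F| <= #|F'|.
Hypothesis S_gt0 : 0 < S.
Hypothesis S_F : 16 * S <= #|F| ^ 2.
Hypothesis S_p : 16 * S <= 2 ^ p.

(** A level at most doubles the product of label count and class bound, and takes [8 * S ^ x.+2]
    down to [8 * S ^ x.+1]. The last one treats a whole class, at most [8 * S] edges, as one group;
    hence [16 * S] in [S_F] and [S_p]. *)
Lemma levels x m M T (tot : labelling nat) :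
  0 < m -> m <= 8 * S ^ x.+1 ->
  computable T.+1 h -> computable T.+1 tot -> symlab tot -> class_le tot m ->
  (forall e id, good e id -> forall z, tot e id z < M) ->
  exists tot' : labelling nat,
    [/\ computable (T.+1 + x.+1 * (p * (3 * #|F'|).+1)) tot', symlab tot',
        class_le tot' 1 &
        forall e id, good e id -> forall z, tot' e id z < M * (2 ^ x.+1 * m)].
Proof.
have hp e id (He : good e id) := (h_proper He).1.
have hl e id (He : good e id) := (h_proper He).2.
elim: x m M T tot => [|x IH] m M T tot m0 lm ch ct st cl lt.
  have [||tot' [c' s' cl' lt']] := level h_sym hp hl card_F' ch ct st cl lt m0 (p := p).
  - by apply: leq_trans S_F; move: lm; rewrite expn1; lia.
  - by apply: leq_trans S_p; move: lm; rewrite expn1; lia.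
  exists tot'; split=> //; first by rewrite mul1n.
    have -> : 1 = (m + m.-1) %/ m; last exact: cl'.
    by rewrite divnDl // divnn m0 divn_small ?addn0 // prednK.
  move=> e id He z; apply: leq_trans (lt' e id He z) _.
  by rewrite leq_mul2l expn1 mul2n leq_pred orbT.
have [s [s0 sS sc /andP[m0' lm']]] := group_size S_gt0 m0 lm.
have [||tot1 [c1 s1 cl1 lt1]] := level h_sym hp hl card_F' ch ct st cl lt s0 (p := p).
- by apply: leq_trans S_F; lia.
- by apply: leq_trans S_p; lia.
rewrite addSn in c1.
have [|tot' [c' s' cl' lt']] := IH _ _ _ _ m0' lm' _ c1 s1 cl1 lt1.
  by rewrite -addSn; apply: computableD.
exists tot'; split=> //; first by rewrite [x.+2 * _]mulSn addnA -addSn in c' *.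
move=> e id He z; apply: leq_trans (lt' e id He z) _.
rewrite -mulnA leq_mul2l; apply/orP; right.
by rewrite mulnCA [2 ^ x.+2]expnS (mulnC 2) -mulnA leq_mul2l sc orbT.
Qed.

End Colouring.

(* IDs are O(log n)-bit: injective into {0, ..., n^K - 1} for a constant K.
   Running time Õ(x * Δ^(1/(2x+2))) + O(log* n), where Õ hides factors
   polylogarithmic in Δ: there are constants C, c with
   rounds <= C * x * ceil(Δ^(1/(2x+2))) * (log2 Δ + 1)^c + C * (log* n + 1). *)
Theorem mainTheorem10 :
  forall K : nat, 0 < K ->
  exists C c : nat,
  forall n Delta x : nat, 0 < x ->
  exists A : LocalAlg,
    la_rounds A <= C * x * root_up Delta (2 * x + 2) * (trunc_log 2 Delta).+1 ^ c
                   + C * (logstar n).+1 /\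
    forall (e : rel 'I_n) (id : 'I_n -> nat),
      simple_graph e -> max_deg e = Delta ->
      injective id -> (forall v, id v < n ^ K) ->
      computes_edge_coloring A e id (2 ^ x.+1 * Delta).
Proof.
(* [2702 = 2 * 7 * 193], from [x.+1 <= 2 * x], [p <= 7 * a] and the bound on [3 * #|F'|]. Of the
   three logarithms one comes from [p] and two from [r.+1 ^ 2]. *)
move=> K K0; exists (2702 * (4 * K + 17) ^ 2), 3 => n Delta x x0.
have [D0|D0] := posnP Delta.
  exists (view_alg 0 (fun _ _ => 0)); split=> // e id _ mD _ _.
  have none u v : e u v = false.
    apply/negP => euv; have : deg e u <= max_deg e.
      by apply: (leq_bigmax u (F := fun v => deg e v)).
    by rewrite mD D0 leqn0 => /eqP/card0_eq/(_ v); rewrite inE euv.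
  by split; [|split] => u v; [| |move=> w]; rewrite none.
set R := root_up _ _; set a := (trunc_log 2 Delta).+1.
have k0 : 0 < 2 * x + 2 by rewrite addn2.
have [lR RD] := root_upP Delta k0; rewrite -/R in lR RD.
have R0 : 0 < R by case: (R) lR => //; rewrite exp0n ?addn2 //; lia.
have lD : Delta < 2 ^ a by apply: trunc_log_ltn.
have [|h [ch sh ph]] := @initial_coloring n Delta (n ^ K) K a.+1 K0 erefl.
  by rewrite expnS ltn_pmul2l.
set r := _ + _ in ph.
(* Each field is the smallest of its kind above its target: [#|F|] is linear in [R], and [#|F'|] is
   larger by a factor of order [r.+1 ^ 2]. *)
have [F cF] := finField_pow2 (ltn0Sn (trunc_log 2 (4 * R))).
have [F' cF'] := finField_pow2 (ltn0Sn (trunc_log 2 (4 * r.+1 ^ 2 * #|F|))).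
set p := (trunc_log 2 (16 * R ^ 2)).+1.
have F1 : 4 * R < #|F| by rewrite cF; apply: trunc_log_ltn.
have F2 : #|F| <= 8 * R.
  rewrite cF expnS; have := @trunc_logP 2 (4 * R) isT; lia.
have F'1 : 4 * r.+1 ^ 2 * #|F| <= #|F'| by rewrite cF'; apply/ltnW/trunc_log_ltn.
have F'2 : #|F'| <= 8 * r.+1 ^ 2 * #|F|.
  rewrite {1}cF' expnS; have := @trunc_logP 2 (4 * r.+1 ^ 2 * #|F|) isT.
  have : 0 < r.+1 ^ 2 by rewrite expn_gt0.
  nia.
have p2 : p <= 7 * a.
  apply: (@leq_trans (2 * a + 5)); last by rewrite /a; lia.
  rewrite addnS ltnS; apply: ltnW; apply: trunc_log_lt; last lia.
  rewrite addnC expnD mul2n -addnn expnD ltn_pmul2l // -mulnn.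
  by apply: ltn_mul; apply: leq_ltn_trans lD.
have S0 : 0 < R ^ 2 by rewrite expn_gt0 R0.
have SF : 16 * R ^ 2 <= #|F| ^ 2 by rewrite -!mulnn; nia.
have Sp : 16 * R ^ 2 <= 2 ^ p by apply/ltnW/trunc_log_ltn.
(* With [S = R ^ 2], the [x.+1] levels suffice for [R ^ (2 * x + 2) >= Delta]. They start from the
   constant label [0], one class of at most [Delta] edges per vertex. *)
have lm : Delta <= 8 * (R ^ 2) ^ x.+1.
  by rewrite -expnM mulnS addnC; move: lR; set y := R ^ _; lia.
have [||||tot [[G HG] st cl lt]] := @levels n Delta (n ^ K) F F' r p (R ^ 2) h sh ph F'1 S0 SF Sp
  x Delta 1 (logstar n) (fun _ _ _ => 0) D0 lm ch.
- exact: computable_const.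
- by [].
- move=> e id u v He euv; apply: leq_trans (deg_le u He); apply: subset_leq_card.
  by apply/subsetP => w; rewrite !inE => /andP[].
- by [].
pose A := view_alg ((logstar n).+1 + x.+1 * (p * (3 * #|F'|).+1)) G.
exists A; split; last first.
  move=> e id sg mD inj lid; have He : good Delta (n ^ K) e id by [].
  have E u v : e u v -> edge_color A e id u v = tot e id (u, v).
    by move=> euv; rewrite /edge_color viewatE /= HG.
  have [es _] := sg.
  split=> [u v euv|]; last split=> [u v euv|u v w euv euw ne].
  - have evu : e v u by rewrite -es.
    by rewrite (E u v euv) (E v u evu); apply/esym/(st e id He (u, v)).
  - by rewrite (E u v euv); have := lt e id He (u, v); rewrite mul1n.
  - rewrite (E u v euv) (E u w euw); apply: contra ne => /eqP Et.
    (* Classes of at most one edge at each vertex amount to properness. *)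
    have /card_le1_eqP H := cl e id u w He euw.
    by apply/eqP/H; rewrite inE ?euv ?euw ?Et eqxx.
rewrite [la_rounds _]/= addnC; apply: leq_add; last first.
  by rewrite leq_pmull // muln_gt0 expn_gt0 /= addn_gt0 orbT.
have rE : r.+1 <= (4 * K + 17) * a by rewrite /r /a; nia.
have r2 : r.+1 ^ 2 <= (4 * K + 17) ^ 2 * a ^ 2 by rewrite -expnMn leq_exp2r.
have rp : 0 < r.+1 ^ 2 by rewrite expn_gt0.
have f3 : (3 * #|F'|).+1 <= 193 * (r.+1 ^ 2 * R).
  have : #|F'| <= 64 * (r.+1 ^ 2 * R).
    by apply: leq_trans F'2 _; have := leq_mul (leqnn (8 * r.+1 ^ 2)) F2; lia.
  have : 0 < r.+1 ^ 2 * R by rewrite muln_gt0 rp.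
  lia.
have f4 : r.+1 ^ 2 * R <= (4 * K + 17) ^ 2 * a ^ 2 * R by rewrite leq_mul2r r2 orbT.
apply: (@leq_trans (2 * x * (7 * a * (193 * ((4 * K + 17) ^ 2 * a ^ 2 * R))))).
  apply: leq_mul; first lia.
  by apply: leq_mul => //; apply: leq_trans f3 _; rewrite leq_mul2l f4 orbT.
by rewrite !expnS expn0; lia.
Qed.
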